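(* Let $(x_k,z_k)_{k\ge0}$ be the random iterates of the Augmented Lagrangian Sketching (ALS) method with fixed penalty $\rho>0$, started at $x_0\in\mathbb{R}^n$, $z_0\in\mathbb{R}^p$, and for $k\ge1$ let $\bar x_k=\frac1k\sum_{l=0}^{k-1}x_l$ and $\bar z_k=\frac1k\sum_{l=0}^{k-1}z_l$. Put $$\mu=\min\big\{\lambda_{\min}^+(\mathbb{E}_{\mathcal D}[B^{-1/2}ZB^{-1/2}]),\ \lambda_{\min}^+(\mathbb{E}_{\mathcal D}[G^{-1/2}WG^{-1/2}])\big\}.$$ Then for every $k\ge1$ $$\mathbb{E}[\mathcal V(\bar x_k,\bar z_k,\rho)]=\mathbb{E}[\|\bar x_k-x^*\|_B^2]+\frac1\rho\mathbb{E}[\|\bar z_k\|_G^2]\le\frac{1}{\mu k}\,\mathcal V(x_0,z_0,\rho),$$ $$2\,\mathbb{E}[f(\bar x_k,\bar z_k,\rho)]=\mathbb{E}[\|\bar x_k-x^*\|^2_{\mathbb{E}_{\mathcal D}[Z]}]+\frac1\rho\mathbb{E}[\|\bar z_k\|^2_{\mathbb{E}_{\mathcal D}[W]}]\le\frac1k\,\mathcal V(x_0,z_0,\rho).$$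
   Context: Let $A\in\mathbb{R}^{m\times n}$ and $b\in\mathbb{R}^m$ be such that the linear system $Ax=b$ is consistent. Let $B\in\mathbb{R}^{n\times n}$ and $G\in\mathbb{R}^{p\times p}$ be symmetric positive definite. For a symmetric positive semidefinite matrix $M$ write $\|x\|_M^2=x^\top Mx$. $\lambda_{\min}^+$ denotes the smallest nonzero eigenvalue of a symmetric positive semidefinite matrix. $\mathcal D$ is a probability distribution on real $m\times p$ matrices and $\mathbb{E}_{\mathcal D}$ is expectation over $S\sim\mathcal D$ (all expectations used are assumed to exist). For $S\sim\mathcal D$ and $\rho>0$ define $$H=\Big(\tfrac1\rho G+S^\top AB^{-1}A^\top S\Big)^{-1},\quad Z=A^\top SHS^\top A,\quad F=\Big(\tfrac1\rho B+A^\top SG^{-1}S^\top A\Big)^{-1},\quad W=S^\top AFA^\top S.$$ Standing assumption on $\mathcal D$: $\mathrm{Null}(\mathbb{E}_{\mathcal D}[SHS^\top])\subseteq\mathrm{Null}(A^\top)$ and $\mathbb{E}_{\mathcal D}[W]\succ0$. ALS method with fixed penalty $\rho$: given deterministic $x_0\in\mathbb{R}^n$, $z_0\in\mathbb{R}^p$, at each iteration $k\ge0$ draw a fresh independent sample $S\sim\mathcal D$ and set $$z_{k+1}=\Big(\tfrac1\rho G+S^\top AB^{-1}A^\top S\Big)^{-1}\Big[S^\top Ax_k-S^\top b+\tfrac1\rho Gz_k\Big],\qquad x_{k+1}=x_k-B^{-1}A^\top Sz_{k+1}.$$ $\mathbb{E}$ denotes total expectation. $x^*=\arg\min\{\|x-x_0\|_B^2: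 Ax=b\}=x_0-B^{-1}A^\top(AB^{-1}A^\top)^\dagger(Ax_0-b)$. Functions: $\mathcal V(x,z,\rho)=\|x-x^*\|_B^2+\frac1\rho\|z\|_G^2$ and $f(x,z,\rho)=\tfrac12\|x-x^*\|^2_{\mathbb{E}_{\mathcal D}[Z]}+\tfrac1{2\rho}\|z\|^2_{\mathbb{E}_{\mathcal D}[W]}$. *)

(* Defs.v *)
From HB Require Import structures.
From mathcomp Require Import all_boot all_order all_algebra finmap.
From mathcomp Require Import all_classical all_reals all_analysis.

Set Implicit Arguments.
Unset Strict Implicit.
Unset Printing Implicit Defensive.

Import Order.TTheory GRing.Theory Num.Theory.
Import numFieldNormedType.Exports.

Local Open Scope classical_set_scope.
Local Open Scope ring_scope.

(* x^T M x; this is ||x||_M^2 when M is positive semidefinite. *)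
Definition qnorm (R : realType) (n : nat) (M : 'M[R]_n) (x : 'cV[R]_n) : R :=
  (x^T *m M *m x) 0 0.

Definition posdefmx (R : realType) (n : nat) (M : 'M[R]_n) : Prop :=
  M^T = M /\ forall x : 'cV[R]_n, x != 0 -> 0 < qnorm M x.

Definition possemidefmx (R : realType) (n : nat) (M : 'M[R]_n) : Prop :=
  M^T = M /\ forall x : 'cV[R]_n, 0 <= qnorm M x.

(* The principal square root: a positive semidefinite M has exactly one
   positive semidefinite square root, so the choice made by xget is forced
   (0 is only the junk value for other M). *)
Definition sqrtmx (R : realType) (n : nat) (M : 'M[R]_n) : 'M[R]_n :=
  xget 0 [set C : 'M[R]_n | possemidefmx C /\ C *m C = M].

Definition invsqrtmx (R : realType) (n : nat) (M : 'M[R]_n) : 'M[R]_n :=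
  invmx (sqrtmx M).

(* The spectrum is finite, so the infimum is attained as soon as there is a
   nonzero eigenvalue; for the zero matrix the value is the junk value inf
   set0 = 0. *)
Definition lambda_min_pos (R : realType) (n : nat) (M : 'M[R]_n) : R :=
  inf [set a : R | eigenvalue M a /\ a != 0].

(* Real matrices with their Borel sigma-algebra. *)
Definition mxborel (R : realType) (m p : nat) :=
  g_sigma_algebraType (@open 'M[R]_(m, p)).

(* Entrywise expectation of a random matrix; [mx_integrable] says that it
   exists. *)
Definition mx_integrable (R : realType) d (T : measurableType d)
    (P : probability T R) (q r : nat) (X : T -> 'M[R]_(q, r)) : Prop :=
  forall i j, P.-integrable [set: T] (fun w => (X w i j)%:E).

Definition mx_expectation (R : realType) d (T : measurableType d)
    (P : probability T R) (q r : nat) (X : T -> 'M[R]_(q, r)) : 'M[R]_(q, r) :=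
  \matrix_(i, j) fine 'E_P[fun w => X w i j].

(* Mutual independence of a sequence of random elements: the product rule
   over every finite set of indices. *)
Definition independent_seq (R : realType) d (T : measurableType d)
    (P : probability T R) d' (T' : measurableType d')
    (X : nat -> {RV P >-> T'}) : Prop :=
  forall (J : {fset nat}) (U : nat -> set T'),
    (forall k, measurable (U k)) ->
    P (\bigcap_(k in [set` J]) (X k @^-1` U k))
      = (\prod_(k <- J) P (X k @^-1` U k))%E.

Definition iid_seq (R : realType) d (T : measurableType d)
    (P : probability T R) d' (T' : measurableType d') (D : probability T' R)
    (X : nat -> {RV P >-> T'}) : Prop :=
  independent_seq X /\
  forall k (U : set T'), measurable U -> distribution P (X k) U = D U.

Section ALS.
Context {R : realType} {m n p : nat}.
Implicit Types (A : 'M[R]_(m, n)) (b : 'cV[R]_m) (B : 'M[R]_n) (G : 'M[R]_p)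
  (rho : R) (S : 'M[R]_(m, p)) (x : 'cV[R]_n) (z : 'cV[R]_p).

Definition als_H A B G rho S : 'M[R]_p :=
  invmx (rho^-1 *: G + S^T *m A *m invmx B *m A^T *m S).

Definition als_SHS A B G rho S : 'M[R]_m :=
  S *m als_H A B G rho S *m S^T.

Definition als_Z A B G rho S : 'M[R]_n :=
  A^T *m S *m als_H A B G rho S *m S^T *m A.

Definition als_F A B G rho S : 'M[R]_n :=
  invmx (rho^-1 *: B + A^T *m S *m invmx G *m S^T *m A).

Definition als_W A B G rho S : 'M[R]_p :=
  S^T *m A *m als_F A B G rho S *m A^T *m S.

Definition als_step A b B G rho S (xz : 'cV[R]_n * 'cV[R]_p) :
    'cV[R]_n * 'cV[R]_p :=
  let: (x, z) := xz in
  let z' := als_H A B G rho S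
              *m (S^T *m A *m x - S^T *m b + rho^-1 *: (G *m z)) in
  (x - invmx B *m A^T *m S *m z', z').

(* The pair (x_k, z_k) produced by the samples s 0, ..., s (k - 1). *)
Fixpoint als_iter A b B G rho x0 z0 (s : nat -> 'M[R]_(m, p)) (k : nat) :
    'cV[R]_n * 'cV[R]_p :=
  if k is k'.+1 then als_step A b B G rho (s k')
                       (als_iter A b B G rho x0 z0 s k')
  else (x0, z0).

Definition als_xbar A b B G rho x0 z0 (s : nat -> 'M[R]_(m, p)) (k : nat) :
    'cV[R]_n :=
  k%:R^-1 *: \sum_(0 <= l < k) (als_iter A b B G rho x0 z0 s l).1.

Definition als_zbar A b B G rho x0 z0 (s : nat -> 'M[R]_(m, p)) (k : nat) :
    'cV[R]_p :=
  k%:R^-1 *: \sum_(0 <= l < k) (als_iter A b B G rho x0 z0 s l).2.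

(* The B-projection of x0 onto the solution set: the minimizer of
   ||x - x0||_B^2 subject to A x = b, which exists and is unique when the
   system is consistent and B is positive definite. *)
Definition als_xstar A b B x0 : 'cV[R]_n :=
  xget 0 [set x : 'cV[R]_n | A *m x = b /\
    forall y : 'cV[R]_n, A *m y = b -> qnorm B (x - x0) <= qnorm B (y - x0)].

Definition als_V B G (xs : 'cV[R]_n) x z rho : R :=
  qnorm B (x - xs) + rho^-1 * qnorm G z.

Definition als_f A B G (D : probability (mxborel R m p) R) (xs : 'cV[R]_n)
    x z rho : R :=
  2^-1 * qnorm (mx_expectation D (als_Z A B G rho)) (x - xs)
  + (2 * rho)^-1 * qnorm (mx_expectation D (als_W A B G rho)) z.

Definition als_mu A B G (D : probability (mxborel R m p) R) rho : R :=
  Num.min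
    (lambda_min_pos (mx_expectation D
      (fun S => invsqrtmx B *m als_Z A B G rho S *m invsqrtmx B)))
    (lambda_min_pos (mx_expectation D
      (fun S => invsqrtmx G *m als_W A B G rho S *m invsqrtmx G))).

End ALS.

(* Main.v *)
(* One ALS step is the resolvent of a linear map that is skew-adjoint for the
   inner product of [V], so [V] decreases by exactly
   [|x - xs|_Z^2 + |z|_W^2 / rho] for every sample; in particular the iterates
   are bounded. The sample [S l] is independent of the iterates up to [l], so in
   expectation the decrement is [2 E f(x_l, z_l)]. Summing over [l] telescopes
   to [V(x_0, z_0)], and convexity of [f] gives the second bound. For the first
   one, [x_l - xs] stays [B]-orthogonal to the null space of [A], which is that
   of [E Z], hence [mu V <= 2 f] at the averaged iterate. *)

Require Import Defs.
From HB Require Import structures.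
From mathcomp Require Import all_boot all_order all_algebra finmap.
From mathcomp Require Import complex ring lra.
From mathcomp Require Import all_classical all_reals all_analysis.
From mathcomp Require Import measurable_realfun.

Set Implicit Arguments.
Unset Strict Implicit.
Unset Printing Implicit Defensive.

Import Order.TTheory GRing.Theory Num.Theory.
Import numFieldNormedType.Exports.

Local Open Scope classical_set_scope.
Local Open Scope ring_scope.

(** * Symmetric matrices *)

(** Spectral facts come from polynomials in a symmetric matrix: two of them agree as soon as they
    agree on the eigenvalues, so square roots and the kernel projector are obtained by
    interpolation. Of the law of [S] only the entrywise means of [SHS], [Z] and [W] are assumed to
    exist, so the integrability of a product such as [Z i j * u i 0 * u j 0] has to come from the
    iterate [u]. The decrement of [V] is nonnegative for every single sample, hence the bound on the
    iterates is deterministic and such products are integrable. No conditional expectation is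
    formed. The product rule for independent samples is extended to the sigma-algebra of the earlier
    samples and applied to each entry of the quadratic form. The first bound divides by [mu], while
    [lambda_min_pos] is 0 on the zero matrix. Positive definiteness of [E W] with [0 < p] excludes
    this for [W], and for [Z] too, because [A = 0] would make every [W] vanish. *)

Section symmetric_calculus.
Variable R : realType.

(** Newton interpolation: a new node is corrected by a multiple of the product that vanishes at the
    old ones. It turns any function on a finite spectrum into a polynomial in the matrix. *)
Lemma poly_interpolation (F : fieldType) (f : F -> F) (s : seq F) :
  exists q : {poly F}, forall a, a \in s -> q.[a] = f a.
Proof.
elim: s => [|a s [q qP]]; first by exists 0.
have [as_|as_] := boolP (a \in s).
  exists q => c; rewrite inE => /predU1P[->|]; exact: qP.
pose r := \prod_(c <- s) ('X - c%:P).
have ra0 : r.[a] != 0 by rewrite -[_ == 0]/(root r a) root_prod_XsubC.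
exists (q + ((f a - q.[a]) / r.[a]) *: r) => c.
rewrite inE hornerD hornerZ => /predU1P[->|cs].
  by rewrite divfK // addrC subrK.
have /rootP -> : root r c by rewrite root_prod_XsubC.
by rewrite mulr0 addr0 qP.
Qed.

(** Over the complex numbers [A] is Hermitian, hence unitarily diagonalizable with a real diagonal
    [r], and [horner_mx A q] is conjugate to the diagonal matrix of the [q.[r i]]. Only this
    consequence is kept: it allows identities between polynomials in [A] to be checked on
    eigenvalues. *)
Lemma symmetric_spectrum (n : nat) (A : 'M[R]_n.+1) : A^T = A ->
  exists rs : seq R, (forall a, eigenvalue A a = (a \in rs)) /\
    forall q, (forall a, a \in rs -> q.[a] = 0) -> horner_mx A q = 0.
Proof.
move=> Asym.
pose f : {rmorphism R -> R[i]} := real_complex R.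
pose AC := map_mx f A.
have ACsym : AC \is hermsymmx.
  apply: realsym_hermsym.
    apply/is_hermitianmxP; rewrite expr0 scale1r; apply/matrixP => i j.
    by rewrite !mxE -[in LHS]Asym mxE.
  by apply/mxOverP => i j; rewrite mxE; apply/complex_realP; exists (A i j).
have /mxOverP dreal := hermitian_spectral_diag_real ACsym.
have /orthomx_spectralP := hermitian_normalmx ACsym.
have Pu := spectral_unit AC.
move: (spectralmx AC) Pu dreal => P Pu dreal ACE.
pose r i := complex.Re (spectral_diag AC 0 i).
have dE i : spectral_diag AC 0 i = f (r i).
  by rewrite /f /= RRe_real.
have rsP q : (forall a, a \in codom r -> q.[a] = 0) -> horner_mx A q = 0.
  move=> q0; apply: (@map_mx_inj _ _ f); rewrite map_mx0 map_horner_mx -/AC.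
  rewrite ACE -{2}[P]invmxK horner_mx_uconj ?unitmx_inv //.
  rewrite horner_mx_diag.
  have -> : map_mx (horner (map_poly f q)) (spectral_diag AC) = 0.
    apply/rowP => i; rewrite !mxE dE horner_map q0 ?rmorph0 //.
    exact: codom_f.
  have -> : diag_mx (0 : 'rV[R[i]]_n.+1) = 0.
    by apply/matrixP => i j; rewrite !mxE mul0rn.
  by rewrite mulmx0 mul0mx.
exists (codom r); split=> // a; apply/idP/idP.
  (* The product of the ['X - a] over the diagonal annihilates [A], so the minimal polynomial
     divides it. *)
  rewrite eigenvalue_root_min -root_prod_XsubC.
  apply: root_dvdp; apply: mxminpoly_min; apply: rsP => c.
  by rewrite -root_prod_XsubC => /rootP.
(* Conversely row [i] of the invertible [P] is an eigenvector for [r i]. *)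
move=> /codomP[i ->]; rewrite -(eigenvalue_map f) -dE -/AC.
apply/eigenvalueP; exists (row i P); last first.
  apply: contraTneq Pu => Pi0; rewrite -row_free_unit.
  apply/negP => /row_freeP[Q PQ1].
  have /(congr1 (row i)) := PQ1; rewrite row_mul Pi0 mul0mx => /rowP/(_ i).
  by rewrite !mxE eqxx => /eqP; rewrite eq_sym oner_eq0.
rewrite {1}ACE -row_mul !mulmxA mulmxV // mul1mx row_mul row_diag_mx.
by rewrite -scalemxAl -rowE.
Qed.

Lemma trmx_horner_mx (n : nat) (A : 'M[R]_n.+1) q :
  A^T = A -> (horner_mx A q)^T = horner_mx A q.
Proof.
move=> As; elim/poly_ind: q => [|q c IH]; first by rewrite rmorph0 trmx0.
rewrite rmorphD rmorphM /= horner_mx_X horner_mx_C linearD /= tr_scalar_mx.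
by rewrite -mulmxE trmx_mul IH As comm_mx_horner.
Qed.

End symmetric_calculus.

(** * Quadratic forms, square roots and the smallest nonzero eigenvalue *)

Section quadratic_forms.
Variable R : realType.
Implicit Types (n m : nat).

Lemma mx11D (X Y : 'M[R]_1) : (X + Y) 0 0 = X 0 0 + Y 0 0.
Proof. by rewrite mxE. Qed.

Lemma mx11Z a (X : 'M[R]_1) : (a *: X) 0 0 = a * X 0 0.
Proof. by rewrite mxE. Qed.

Lemma qnormDl n (M N : 'M[R]_n) x : qnorm (M + N) x = qnorm M x + qnorm N x.
Proof. by rewrite /qnorm mulmxDr mulmxDl mxE. Qed.

Lemma qnormZl n a (M : 'M[R]_n) x : qnorm (a *: M) x = a * qnorm M x.
Proof. by rewrite /qnorm -scalemxAr -scalemxAl mxE. Qed.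

Lemma qnormZr n a (M : 'M[R]_n) x : qnorm M (a *: x) = a ^+ 2 * qnorm M x.
Proof.
rewrite /qnorm -scalemxAr [(_ *: x)^T]linearZ /= -!scalemxAl !mxE.
by rewrite mulrA expr2.
Qed.

Lemma qnorm0r n (M : 'M[R]_n) : qnorm M 0 = 0.
Proof. by rewrite /qnorm mulmx0 mxE. Qed.

Lemma qnorm0l n (x : 'cV[R]_n) : qnorm 0 x = 0.
Proof. by rewrite /qnorm mulmx0 mul0mx mxE. Qed.

Lemma qnormDr n (M : 'M[R]_n) x y : M^T = M ->
  qnorm M (x + y) = qnorm M x + qnorm M y + 2 * (x^T *m M *m y) 0 0.
Proof.
move=> Ms; have E : y^T *m M *m x = (x^T *m M *m y)^T.
  by rewrite !trmx_mul trmxK Ms mulmxA.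
rewrite /qnorm [(x + y)^T]linearD /= !mulmxDl !mulmxDr E !mxE; ring.
Qed.

Lemma trmx_sum_mul I (s : seq I) n (a : I -> 'cV[R]_n) (M : 'M[R]_n)
    (v : 'cV[R]_n) :
  ((\sum_(i <- s) a i)^T *m M *m v) 0 0 =
  \sum_(i <- s) ((a i)^T *m M *m v) 0 0.
Proof.
elim: s => [|i s IH]; first by rewrite !big_nil trmx0 !mul0mx mxE.
by rewrite !big_cons -IH [(_ + _)^T]linearD /= !mulmxDl mxE.
Qed.

Lemma qnorm_mull n m (C : 'M[R]_(m, n)) (M : 'M[R]_m) x :
  qnorm (C^T *m M *m C) x = qnorm M (C *m x).
Proof. by rewrite /qnorm trmx_mul !mulmxA. Qed.

Lemma qnorm_entries n (M : 'M[R]_n) x :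
  qnorm M x = \sum_i \sum_j x i 0 * M i j * x j 0.
Proof.
rewrite /qnorm mxE exchange_big; apply: eq_bigr => j _.
by rewrite mxE mulr_suml; apply: eq_bigr => i _; rewrite mxE.
Qed.

Lemma qnorm1E n (x : 'cV[R]_n) : qnorm 1%:M x = \sum_i x i 0 ^+ 2.
Proof.
by rewrite /qnorm mulmx1 mxE; apply: eq_bigr => i _; rewrite mxE expr2.
Qed.

Lemma qnorm1_ge0 n (x : 'cV[R]_n) : 0 <= qnorm 1%:M x.
Proof. by rewrite qnorm1E sumr_ge0 // => i _; exact: sqr_ge0. Qed.

Lemma qnorm1_eq0 n (x : 'cV[R]_n) : qnorm 1%:M x = 0 -> x = 0.
Proof.
rewrite qnorm1E => /eqP; rewrite psumr_eq0 => [|i _]; last exact: sqr_ge0.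
move=> /allP x0; apply/colP => i; apply/eqP; rewrite mxE -sqrf_eq0.
by apply: x0; rewrite mem_index_enum.
Qed.

Lemma qnorm_sym_sqr n (C : 'M[R]_n) x : C^T = C ->
  qnorm (C *m C) x = qnorm 1%:M (C *m x).
Proof. by move=> Cs; rewrite -qnorm_mull Cs mulmx1. Qed.

Lemma possemidefmx_sym_sqr n (C : 'M[R]_n) : C^T = C -> possemidefmx (C *m C).
Proof.
move=> Cs; split=> [|x]; first by rewrite trmx_mul Cs.
by rewrite qnorm_sym_sqr // qnorm1_ge0.
Qed.

Lemma posdefmx_psd n (M : 'M[R]_n) : posdefmx M -> possemidefmx M.
Proof.
case=> Ms Mp; split=> // x.
by have [->|/Mp/ltW//] := eqVneq x 0; rewrite qnorm0r.
Qed.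

Lemma eigenvalue_qnorm n (M : 'M[R]_n) a : M^T = M -> eigenvalue M a ->
  exists2 x : 'cV[R]_n, x != 0 & qnorm M x = a * qnorm 1%:M x.
Proof.
move=> Ms /eigenvalueP[v vM v0]; exists v^T.
  by apply: contra_neq v0 => v0; rewrite -[v]trmxK v0 trmx0.
by rewrite /qnorm trmxK vM mulmx1 -scalemxAl mxE.
Qed.

Lemma possemidefmx_eigenvalue n (M : 'M[R]_n) a :
  possemidefmx M -> eigenvalue M a -> 0 <= a.
Proof.
case=> Ms Mp /(eigenvalue_qnorm Ms)[x x0 E].
have: 0 < qnorm 1%:M x.
  rewrite lt_def qnorm1_ge0 andbT; apply: contra_neq x0; exact: qnorm1_eq0.
by move=> /pmulr_lge0 <-; rewrite -E.
Qed.

(** Interpolating the fourth root makes the candidate the square of a symmetric matrix, hence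
    positive semidefinite without a look at its spectrum. *)
Lemma possemidefmx_sqrt n (M : 'M[R]_n) :
  possemidefmx M -> exists C, possemidefmx C /\ C *m C = M.
Proof.
case: n M => [|n] M Mp.
  by exists M; split=> //; apply/matrixP => -[].
have Ms := Mp.1; have [rs [rsE rs0]] := symmetric_spectrum Ms.
have [q qP] := poly_interpolation (fun a => Num.sqrt (Num.sqrt a)) rs.
have Cs := trmx_horner_mx q Ms.
exists (horner_mx M q *m horner_mx M q); split.
  exact: possemidefmx_sym_sqr.
have : horner_mx M (q * q * (q * q) - 'X) = 0.
  apply: rs0 => a ars; have a0 : 0 <= a.
    by apply: possemidefmx_eigenvalue Mp _; rewrite rsE.
  rewrite hornerD hornerN hornerX !hornerM qP // -!expr2.
  by rewrite !sqr_sqrtr ?sqrtr_ge0 // subrr.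
by rewrite rmorphB !rmorphM /= horner_mx_X => /eqP; rewrite subr_eq0 => /eqP.
Qed.

Lemma possemidefmx_ker n (M : 'M[R]_n) x :
  possemidefmx M -> qnorm M x = 0 -> M *m x = 0.
Proof.
move=> /possemidefmx_sqrt[C [[Cs _] <-]].
by rewrite qnorm_sym_sqr // => /qnorm1_eq0 Cx; rewrite -mulmxA Cx mulmx0.
Qed.

Lemma posdefmx_unit n (M : 'M[R]_n) : posdefmx M -> M \in unitmx.
Proof.
case=> Ms Mp; rewrite -row_free_unit; apply/inj_row_free => v vM.
apply/eqP; apply: contraT => v0.
have := Mp v^T; rewrite /qnorm trmxK vM mul0mx mxE ltxx; apply.
by apply: contra_neq v0 => v0; rewrite -[v]trmxK v0 trmx0.
Qed.

Lemma posdefmx_inv n (M : 'M[R]_n) : posdefmx M -> posdefmx (invmx M).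
Proof.
move=> Mp; have Mu := posdefmx_unit Mp.
split=> [|x x0]; first by rewrite trmx_inv Mp.1.
have -> : invmx M = (invmx M)^T *m M *m invmx M.
  by rewrite trmx_inv Mp.1 mulVmx // mul1mx.
rewrite qnorm_mull; apply: Mp.2; apply: contra_neq x0 => x0.
by rewrite -[x](mulKVmx Mu) x0 mulmx0.
Qed.

Lemma possemidefmx_congr n m (C : 'M[R]_(m, n)) (M : 'M[R]_m) :
  possemidefmx M -> possemidefmx (C^T *m M *m C).
Proof.
case=> Ms Mp; split=> [|x]; last by rewrite qnorm_mull.
by rewrite !trmx_mul trmxK Ms mulmxA.
Qed.

Lemma posdefmxD n (M N : 'M[R]_n) :
  posdefmx M -> possemidefmx N -> posdefmx (M + N).
Proof.
move=> [Ms Mp] [Ns Np]; split=> [|x /Mp Mx]; first by rewrite linearD /= Ms Ns.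
by rewrite qnormDl ltr_wpDr.
Qed.

Lemma posdefmxZ n a (M : 'M[R]_n) : 0 < a -> posdefmx M -> posdefmx (a *: M).
Proof.
move=> a0 [Ms Mp]; split=> [|x /Mp Mx]; first by rewrite linearZ /= Ms.
by rewrite qnormZl mulr_gt0.
Qed.

Lemma sqrtmxP n (M : 'M[R]_n) : possemidefmx M ->
  possemidefmx (sqrtmx M) /\ sqrtmx M *m sqrtmx M = M.
Proof.
move=> /possemidefmx_sqrt[C CP].
apply: (@xgetPex _ 0 [set C : 'M[R]_n | possemidefmx C /\ C *m C = M]).
by exists C.
Qed.

Lemma sqrtmx_unit n (M : 'M[R]_n) : posdefmx M -> sqrtmx M \in unitmx.
Proof.
move=> Mp; have := posdefmx_unit Mp.
by have [_ {1}<-] := sqrtmxP (posdefmx_psd Mp); rewrite unitmx_mul => /andP[].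
Qed.

Lemma invsqrtmx_sym n (M : 'M[R]_n) : posdefmx M ->
  (invsqrtmx M)^T = invsqrtmx M.
Proof. by move=> /posdefmx_psd/sqrtmxP[[Cs _] _]; rewrite trmx_inv Cs. Qed.

Lemma lambda_min_pos_gt0 n (M : 'M[R]_n) : possemidefmx M -> M != 0 ->
  0 < lambda_min_pos M.
Proof.
case: n M => [|n] M Mp M0; first by rewrite (flatmx0 M) eqxx in M0.
have [rs [rsE rs0]] := symmetric_spectrum Mp.1.
have rs_ge0 a : a \in rs -> 0 <= a.
  by rewrite -rsE; exact: possemidefmx_eigenvalue.
(* The spectrum is finite and nonnegative, so its nonzero part has a positive lower bound. *)
have [c c0 cP] : exists2 c : R, 0 < c & forall a, a \in rs -> a != 0 -> c <= a.
  elim: rs rs_ge0 {rsE rs0} => [|a rs IH] ge0; first by exists 1.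
  have [|c c0 cP] := IH.
    by move=> b brs; apply: ge0; rewrite inE brs orbT.
  have [a0|a0] := eqVneq a 0.
    by exists c => // b; rewrite inE => /predU1P[->|/cP//]; rewrite a0 eqxx.
  exists (Num.min a c) => [|b].
    by rewrite lt_min c0 lt_def a0 ge0 // mem_head.
  rewrite inE ge_min => /predU1P[->|/cP H /H ->]; first by rewrite lexx.
  by rewrite orbT.
apply: lt_le_trans c0 _; apply: lb_le_inf; last first.
  by move=> a /= [aM a0]; apply: cP => //; rewrite -rsE.
(* The infimum is not over the empty set: if 0 were the only eigenvalue, ['X] would vanish on the
   spectrum and [M] would be 0. *)
apply: contrapT => noeig; case/negP: M0.
apply/eqP; rewrite -(horner_mx_X M); apply: rs0 => a ars; rewrite hornerX.
apply: contrapT => /eqP a0; apply: noeig; exists a; split=> //=.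
by rewrite rsE.
Qed.

(* With [c] the smallest nonzero eigenvalue and [e] the indicator of [0],
   [t - c + c * e t] is nonnegative on the spectrum, hence equal there to the
   square of some polynomial [q]; [e M] projects onto the kernel of [M]. *)
Lemma lambda_min_pos_qnorm n (M : 'M[R]_n) (v : 'cV[R]_n) : possemidefmx M ->
  (forall w : 'cV[R]_n, M *m w = 0 -> (v^T *m w) 0 0 = 0) ->
  lambda_min_pos M * qnorm 1%:M v <= qnorm M v.
Proof.
case: n M v => [|n] M v Mp vker.
  by rewrite (flatmx0 v) !qnorm0r mulr0.
have Ms := Mp.1; have [rs [rsE rs0]] := symmetric_spectrum Ms.
set c := lambda_min_pos M.
have cP a : a \in rs -> a != 0 -> c <= a.
  move=> ars a0; apply: ge_inf; last by split=> //=; rewrite rsE.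
  by exists 0 => b /= [bM _]; exact: possemidefmx_eigenvalue bM.
have [e eP] := poly_interpolation (fun a : R => (a == 0)%:R) rs.
have [q qP] := poly_interpolation
  (fun a : R => Num.sqrt (a - c + c * (a == 0)%:R)) rs.
have ker_e : M *m horner_mx M e = 0.
  have := rs0 ('X * e); rewrite rmorphM /= horner_mx_X; apply => a ars.
  by rewrite !hornerE eP //; have [->|] := eqVneq a 0; rewrite ?mul0r ?mulr0.
have sqr_q : horner_mx M q *m horner_mx M q = M - c%:M + c *: horner_mx M e.
  have := rs0 (q * q - ('X - c%:P + c *: e)).
  rewrite !(rmorphB, rmorphD) rmorphM /= horner_mx_X horner_mx_C horner_mxZ.
  move=> H; apply/eqP; rewrite -subr_eq0; apply/eqP; apply: H => a ars.
  rewrite !(hornerD, hornerN) hornerZ hornerX hornerC hornerM qP //.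
  rewrite -expr2 sqr_sqrtr ?eP ?subrr //.
  have [->|a0] := eqVneq a 0; first by rewrite mulr1 sub0r addrC subrr.
  by rewrite mulr0 addr0 subr_ge0 cP.
have := (possemidefmx_sym_sqr (trmx_horner_mx q Ms)).2 v.
rewrite sqr_q -[c%:M]scalemx1 -scaleNr 2!qnormDl !qnormZl.
have -> : qnorm (horner_mx M e) v = 0.
  by rewrite /qnorm -mulmxA; apply: vker; rewrite mulmxA ker_e mul0mx.
lra.
Qed.

Lemma quad_poly_ge0 (a b : R) : 0 <= a ->
  (forall t, 0 <= t ^+ 2 * a + 2 * t * b) -> b = 0.
Proof.
(* The minimizer is [- b / a]; the shift to [a + 1] also covers [a = 0] and still gives a negative
   value unless [b = 0]. *)
move=> a0 /(_ (- b / (a + 1))) H.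
have a1 : 0 < a + 1 by lra.
have: 0 <= - (b ^+ 2) * (a + 2).
  have -> : - (b ^+ 2) * (a + 2) = (a + 1) ^+ 2 *
      ((- b / (a + 1)) ^+ 2 * a + 2 * (- b / (a + 1)) * b).
    by field; rewrite gt_eqF.
  by rewrite mulr_ge0 ?sqr_ge0.
rewrite pmulr_lge0 ?oppr_ge0; last by lra.
by move=> H2; apply/eqP; rewrite -sqrf_eq0 eq_le H2 sqr_ge0.
Qed.

End quadratic_forms.

(** * One ALS step *)

Section als_identities.
Variables (R : realType) (m n p : nat) (A : 'M[R]_(m, n)) (b : 'cV[R]_m).
Variables (B : 'M[R]_n) (G : 'M[R]_p) (rho : R).
Hypotheses (B_pd : posdefmx B) (G_pd : posdefmx G) (rho_gt0 : 0 < rho).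
Implicit Types (S : 'M[R]_(m, p)) (x u v : 'cV[R]_n) (z : 'cV[R]_p).

Let rhoV_gt0 : 0 < rho^-1. Proof. by rewrite invr_gt0. Qed.

Local Notation N S := (S^T *m A *m invmx B *m A^T *m S).
Local Notation K S := (rho^-1 *: G + N S).
Local Notation KF S := (rho^-1 *: B + A^T *m S *m invmx G *m S^T *m A).
Local Notation H S := (als_H A B G rho S).
Local Notation Z S := (als_Z A B G rho S).
Local Notation W S := (als_W A B G rho S).

Lemma als_N_psd S : possemidefmx (N S).
Proof.
have := possemidefmx_congr (A^T *m S) (posdefmx_psd (posdefmx_inv B_pd)).
by rewrite trmx_mul trmxK !mulmxA.
Qed.

Lemma als_K_pd S : posdefmx (K S).
Proof. exact: posdefmxD (posdefmxZ rhoV_gt0 G_pd) (als_N_psd S). Qed.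

Lemma als_KF_pd S : posdefmx (KF S).
Proof.
apply: posdefmxD; first exact: posdefmxZ.
have := possemidefmx_congr (S^T *m A) (posdefmx_psd (posdefmx_inv G_pd)).
by rewrite trmx_mul trmxK !mulmxA.
Qed.

Lemma als_H_psd S : possemidefmx (H S).
Proof. exact/posdefmx_psd/posdefmx_inv/als_K_pd. Qed.

Lemma als_SHS_psd S : possemidefmx (als_SHS A B G rho S).
Proof. by have := possemidefmx_congr S^T (als_H_psd S); rewrite trmxK. Qed.

Lemma als_ZE S : Z S = (S^T *m A)^T *m H S *m (S^T *m A).
Proof. by rewrite trmx_mul trmxK /als_Z !mulmxA. Qed.

Lemma als_Z_SHS S : Z S = A^T *m als_SHS A B G rho S *m A.
Proof. by rewrite /als_Z /als_SHS !mulmxA. Qed.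

Lemma als_Z_psd S : possemidefmx (Z S).
Proof. by rewrite als_ZE; exact/possemidefmx_congr/als_H_psd. Qed.

Lemma als_W_psd S : possemidefmx (W S).
Proof.
have := possemidefmx_congr (A^T *m S) (posdefmx_psd (posdefmx_inv (als_KF_pd S))).
by rewrite trmx_mul trmxK !mulmxA.
Qed.

(* Follows from the push-through identity [KF B^-1 A^T S = A^T S G^-1 K]. *)
Lemma als_W_woodbury S : rho^-1 *: W S = N S - N S *m H S *m N S.
Proof.
have Ku := posdefmx_unit (als_K_pd S); have KFu := posdefmx_unit (als_KF_pd S).
have Bu := posdefmx_unit B_pd; have Gu := posdefmx_unit G_pd.
have push : KF S *m (invmx B *m A^T *m S) = A^T *m S *m invmx G *m K S.
  rewrite mulmxDl mulmxDr -scalemxAl -scalemxAr !mulmxA mulmxV // mul1mx.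
  by rewrite mulmxKV.
have HF : invmx B *m A^T *m S *m H S =
    als_F A B G rho S *m (A^T *m S *m invmx G).
  by rewrite -[LHS](mulKmx KFu) [KF S *m _]mulmxA push /als_H mulmxK.
have NH : N S *m H S = W S *m invmx G.
  transitivity (S^T *m A *m (invmx B *m A^T *m S *m H S)).
    by rewrite !mulmxA.
  by rewrite HF !mulmxA.
have -> : N S - N S *m H S *m N S = N S *m H S *m (rho^-1 *: G).
  have -> : rho^-1 *: G = K S - N S by rewrite addrK.
  by rewrite mulmxBr /als_H mulmxKV.
by rewrite NH -scalemxAr mulmxKV.
Qed.

(** With [u = x - xs], [a = S^T A u] and [y = rho^-1 G z] one has [z' = H (a + y)]. The squared step
    length is [|z'|_N^2], which with [rho^-1 |z'|_G^2] makes [|z'|_K^2 = |a + y|_H^2]. The cross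
    term is [- 2 a^T H (a + y)], so what remains besides [|u|_B^2] is [|y|_H^2 - |a|_H^2]. Here
    [|a|_H^2 = |u|_Z^2], and [|y|_H^2] is evaluated by [als_W_woodbury]. *)
Lemma als_V_step S xs x z : A *m xs = b ->
  let xz := als_step A b B G rho S (x, z) in
  als_V B G xs xz.1 xz.2 rho =
  als_V B G xs x z rho - (qnorm (Z S) (x - xs) + rho^-1 * qnorm (W S) z).
Proof.
move=> xsE /=; rewrite /als_V.
have Ku := posdefmx_unit (als_K_pd S); have Bu := posdefmx_unit B_pd.
have Hs := (als_H_psd S).1.
pose u : 'cV[R]_n := x - xs; rewrite -[x - xs]/u.
pose a := S^T *m A *m u; pose y := rho^-1 *: G *m z.
have -> : S^T *m A *m x - S^T *m b + rho^-1 *: (G *m z) = a + y.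
  by rewrite /a /y /u -xsE mulmxBr mulmxA scalemxAl.
set z' := H S *m (a + y).
have -> : x - invmx B *m A^T *m S *m z' - xs =
    u + (- (invmx B *m A^T *m S)) *m z'.
  by rewrite mulNmx /u addrAC.
rewrite qnormDr ?B_pd.1 // -qnorm_mull.
have -> : (- (invmx B *m A^T *m S))^T *m B *m (- (invmx B *m A^T *m S)) = N S.
  rewrite [(- _)^T]linearN /= !mulNmx mulmxN opprK !trmx_mul trmxK trmx_inv.
  by rewrite B_pd.1 !mulmxA mulmxKV.
have -> : u^T *m B *m (- (invmx B *m A^T *m S) *m z') =
    - (a^T *m H S *m (a + y)).
  rewrite mulNmx mulmxN /z' /a !trmx_mul trmxK !mulmxA.
  by rewrite -[u^T *m B *m _](mulmxA) mulmxV // mulmx1.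
have -> : rho^-1 * qnorm G z' = qnorm (K S) z' - qnorm (N S) z'.
  by rewrite -qnormZl qnormDl addrK.
have -> : qnorm (K S) z' = qnorm (H S) (a + y).
  by rewrite /z' -qnorm_mull Hs /als_H mulVmx // mul1mx.
have Ha : qnorm (Z S) u = qnorm (H S) a by rewrite als_ZE qnorm_mull.
have Hy : qnorm (H S) y = rho^-1 * qnorm G z - rho^-1 * qnorm (W S) z.
  (* As [rho^-1 G = K - N] and [H] inverts [K], sandwiching [H] gives [K - 2 N + N H N], that is
     [rho^-1 G - rho^-1 W]. *)
  have KHK : (K S - N S) *m H S *m (K S - N S) =
      (K S - N S) + (-1) *: (N S - N S *m H S *m N S).
    rewrite !mulmxBl !mulmxBr {1}/als_H mulmxV // mul1mx /als_H mulmxKV //.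
    by rewrite mul1mx scaleN1r.
  have Gs : (rho^-1 *: G)^T = rho^-1 *: G by rewrite [LHS]linearZ /= G_pd.1.
  rewrite /y -qnorm_mull -!qnormZl als_W_woodbury Gs.
  have -> : rho^-1 *: G = K S - N S by rewrite addrK.
  by rewrite KHK qnormDl qnormZl mulN1r.
have -> : (- (a^T *m H S *m (a + y))) 0 0 =
    - qnorm (H S) a - (a^T *m H S *m y) 0 0.
  by rewrite mulmxDr mxE mx11D opprD.
rewrite Ha (qnormDr a y Hs); move: Hy; lra.
Qed.

(** The displacement lies in the range of [B^-1 A^T], which is the [B]-orthogonal complement of the
    null space of [A]. *)
Lemma als_step_orthogonal S xs x z v : A *m xs = b -> A *m v = 0 ->
  ((x - xs)^T *m B *m v) 0 0 = 0 ->
  (((als_step A b B G rho S (x, z)).1 - xs)^T *m B *m v) 0 0 = 0.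
Proof.
move=> xsE Av0 xv0 /=; move: (als_H A B G rho S *m _) => z'.
rewrite addrAC [(_ - _ *m z')^T]linearB /= !mulmxBl mxE xv0 add0r mxE.
rewrite !trmx_mul trmxK trmx_inv B_pd.1 -!mulmxA mulKmx ?posdefmx_unit //.
by rewrite Av0 !mulmx0 mxE oppr0.
Qed.

Lemma als_xstarP x0 : (exists x, A *m x = b) ->
  let xs := als_xstar A b B x0 in
  A *m xs = b /\
  forall v, A *m v = 0 -> ((x0 - xs)^T *m B *m v) 0 0 = 0.
Proof.
move=> [x1 x1E] xs.
have Bu := posdefmx_unit B_pd; have BVpd := posdefmx_inv B_pd.
have [y yE] : exists y, A *m (invmx B *m A^T *m y) = A *m (x0 - x1).
  (* [A B^-1 A^T] has the rank of [A]: if [w = y A] is killed by [B^-1 A^T], then [w B^-1 w^T = 0],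
     so [w = 0]. *)
  have rk : (A^T <= A *m (invmx B *m A^T))%MS.
    rewrite -(geq_leqif (mxrank_leqif_sup _)); last first.
      by rewrite mulmxA submxMl.
    rewrite mxrank_tr -(mxrank_mul_ker A (invmx B *m A^T)).
    suff -> : (A :&: kermx (invmx B *m A^T))%MS = 0 by rewrite mxrank0 addn0.
    apply/eqP; rewrite -submx0; apply/rV_subP => w.
    rewrite sub_capmx => /andP[/submxP[y ->] /sub_kermxP yK].
    rewrite mulmxA in yK.
    have /(congr1 (mulmx B)) : invmx B *m (y *m A)^T = 0.
      apply: possemidefmx_ker (posdefmx_psd BVpd) _.
      by rewrite /qnorm trmxK trmx_mul mulmxA yK mul0mx mxE.
    rewrite mulKVmx // mulmx0 => /(congr1 trmx).
    by rewrite trmxK trmx0 => ->; rewrite sub0mx.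
  (* Transposing [A^T = C A B^-1 A^T] gives [A = A B^-1 A^T C^T], which exhibits the solution
     [y]. *)
  have /submxP[C /(congr1 trmx)] := rk.
  rewrite !trmx_mul !trmxK BVpd.1 => AE; exists (C^T *m (x0 - x1)).
  by rewrite {3}AE !mulmxA.
have ex : exists x, [set x : 'cV[R]_n | A *m x = b /\
    forall y : 'cV[R]_n, A *m y = b -> qnorm B (x - x0) <= qnorm B (y - x0)] x.
  (* [x0 - w] is the projection: [w^T B = y^T A] vanishes on differences of solutions, so the cross
     term below is 0. *)
  pose w := invmx B *m A^T *m y; have xE : A *m (x0 - w) = b.
    by rewrite mulmxBr yE mulmxBr x1E opprB addrC subrK.
  exists (x0 - w); split=> // y' y'E.
  rewrite (_ : y' - x0 = (x0 - w - x0) + (y' - (x0 - w))); last first.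
    by rewrite [RHS]addrC addrA subrK.
  rewrite [leRHS]qnormDr ?B_pd.1 // -[_ + _ + 2 * _]addrA lerDl.
  rewrite (_ : _^T *m B *m _ = 0) ?mxE ?mulr0 ?addr0.
    exact: (posdefmx_psd B_pd).2.
  rewrite addrAC subrr sub0r [(- _)^T]linearN /= !mulNmx.
  have -> : w^T *m B = y^T *m A.
    by rewrite /w !trmx_mul trmxK BVpd.1 mulmxA mulmxKV.
  by rewrite -mulmxA mulmxBr xE y'E subrr mulmx0 oppr0.
have [xsE xsmin] := xgetPex 0 ex; split=> // v Av0.
rewrite -opprB [(- _)^T]linearN /= !mulNmx mxE.
apply/eqP; rewrite oppr_eq0; apply/eqP.
apply: (@quad_poly_ge0 _ (qnorm B v)); first exact: (posdefmx_psd B_pd).2.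
(* First-order optimality: [xs + t v] is feasible for all [t], and minimality is a nonnegative
   quadratic polynomial in [t] whose linear coefficient must vanish. *)
move=> t; have := xsmin (xs + t *: v).
rewrite mulmxDr -scalemxAr Av0 scaler0 addr0 => /(_ xsE).
rewrite addrAC [leRHS]qnormDr ?B_pd.1 // qnormZr -[_ + _ + 2 * _]addrA lerDl.
by rewrite -scalemxAr mx11Z mulrA.
Qed.

End als_identities.

(** * Measurability, independence and expectation *)

Section measurable_matrices.
Context {R : realType} {d : measure_display} {T : measurableType d}.

(** Entrywise instead of through [mxborel], so that matrix operations reduce to sums and products of
    real measurable functions. *)
Definition mx_measurable (q r : nat) (X : T -> 'M[R]_(q, r)) :=
  forall i j, measurable_fun [set: T] (fun w => X w i j).

Lemma measurable_invr (f : T -> R) : (forall w, f w != 0) ->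
  measurable_fun setT f -> measurable_fun setT (fun w => (f w)^-1).
Proof.
move=> f0 mf.
have oD : open [set x : R | x != 0] by exact: open_neq.
apply: (measurable_comp (F := [set x : R | x != 0])).
- exact: open_measurable.
- by move=> _ [w _ <-] /=.
- apply: open_continuous_measurable_fun => // x; rewrite inE /= => x0.
  exact: inv_continuous.
- exact: mf.
Qed.

Lemma mx_measurable_cst q r (M : 'M[R]_(q, r)) : mx_measurable (fun=> M).
Proof. by move=> i j; exact: measurable_cst. Qed.

Lemma mx_measurableD q r (X Y : T -> 'M[R]_(q, r)) :
  mx_measurable X -> mx_measurable Y -> mx_measurable (fun w => X w + Y w).
Proof.
move=> mX mY i j; under eq_fun do rewrite mxE.
exact: measurable_funD.
Qed.

Lemma mx_measurableN q r (X : T -> 'M[R]_(q, r)) :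
  mx_measurable X -> mx_measurable (fun w => - X w).
Proof.
move=> mX i j; under eq_fun do rewrite mxE.
exact: measurable_funN.
Qed.

Lemma mx_measurableM q r s (X : T -> 'M[R]_(q, r)) (Y : T -> 'M[R]_(r, s)) :
  mx_measurable X -> mx_measurable Y -> mx_measurable (fun w => X w *m Y w).
Proof.
move=> mX mY i j; under eq_fun do rewrite mxE.
by apply: measurable_sum => l; exact: measurable_funM.
Qed.

Lemma mx_measurableZ q r a (X : T -> 'M[R]_(q, r)) :
  mx_measurable X -> mx_measurable (fun w => a *: X w).
Proof.
move=> mX i j; under eq_fun do rewrite mxE.
exact: measurable_funM.
Qed.

Lemma mx_measurable_tr q r (X : T -> 'M[R]_(q, r)) :
  mx_measurable X -> mx_measurable (fun w => (X w)^T).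
Proof. by move=> mX i j; under eq_fun do rewrite mxE; exact: mX. Qed.

Lemma measurable_det q (X : T -> 'M[R]_q) :
  mx_measurable X -> measurable_fun setT (fun w => \det (X w)).
Proof.
move=> mX; apply: measurable_sum => s; apply: measurable_funM => //.
by apply: measurable_prod => i _.
Qed.

(** Cramer's rule: the entries are cofactors divided by a determinant that never vanishes. *)
Lemma mx_measurable_inv q (X : T -> 'M[R]_q) :
  (forall w, X w \in unitmx) -> mx_measurable X ->
  mx_measurable (fun w => invmx (X w)).
Proof.
move=> Xu mX i j.
under eq_fun do rewrite /invmx Xu mxE.
apply: measurable_funM.
  apply: measurable_invr (measurable_det mX) => w.
  by rewrite -unitfE -unitmxE.
under eq_fun do rewrite mxE /cofactor.
apply: measurable_funM => //; apply: measurable_det => i' j'.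
by under eq_fun do rewrite !mxE; exact: mX.
Qed.

End measurable_matrices.

Lemma mx_measurable_mxborel (R : realType) (m p : nat) d (T : measurableType d)
    (f : T -> mxborel R m p) :
  measurable_fun setT f -> mx_measurable (f : T -> 'M[R]_(m, p)).
Proof.
move=> mf i j.
apply: (@measurableT_comp _ _ _ _ _ _ (fun S : mxborel R m p => S i j)) mf.
apply: (@measurability _ _ _ _ _ _ (@RGenOpens.G R)).
  exact: RGenOpens.measurableE.
move=> _ [_ [x [y ->]] <-].
rewrite setTI; apply: sub_sigma_algebra.
apply: open_comp (interval_open _ _) => // S _; exact: coord_continuous.
Qed.

(** * Integral of a product of independent variables *)

Section independence.
Context {R : realType} {d : measure_display} {Omega : measurableType d}.
Variable P : probability Omega R.

(** The hypothesis says that the law of [(X, Y)] agrees with the product of the two laws on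
    rectangles, hence everywhere; Fubini then factors the integral. *)
Lemma independent_Rintegral (X Y : Omega -> R) :
  P.-integrable setT (EFin \o X) -> P.-integrable setT (EFin \o Y) ->
  (forall U V : set R, measurable U -> measurable V ->
     P (X @^-1` U `&` Y @^-1` V) = (P (X @^-1` U) * P (Y @^-1` V))%E) ->
  P.-integrable setT (EFin \o (fun w => X w * Y w)) /\
  \int[P]_w (X w * Y w) = (\int[P]_w X w) * (\int[P]_w Y w).
Proof.
move=> iX iY indep.
have mX : measurable_fun setT X by move/measurable_int/measurable_EFinP : iX.
have mY : measurable_fun setT Y by move/measurable_int/measurable_EFinP : iY.
pose X' : {mfun Omega >-> R} :=
  MeasurableFun.Pack (MeasurableFun.Class (isMeasurableFun.Build _ _ _ _ X mX)).
pose Y' : {mfun Omega >-> R} :=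
  MeasurableFun.Pack (MeasurableFun.Class (isMeasurableFun.Build _ _ _ _ Y mY)).
have mXY : measurable_fun setT (fun w => (X w, Y w)).
  exact: measurable_fun_pair.
pose XY : {mfun Omega >-> (R * R)%type} := MeasurableFun.Pack
  (MeasurableFun.Class (isMeasurableFun.Build _ _ _ _ _ mXY)).
pose m1 := distribution P X'; pose m2 := distribution P Y'.
pose m12 := distribution P XY.
pose f : (R * R)%type -> \bar R := fun z => (z.1 * z.2)%:E.
have mf : measurable_fun setT f.
  by apply/measurable_EFinP; apply: measurable_funM.
have E12 A : measurable A -> A `<=` setT -> (m1 \x m2)%E A = m12 A.
  move=> mA _; exact: product_measure_unique.
have mabs : measurable_fun setT (fun y : R => `|y%:E|%E).
  by do 2 apply: measurableT_comp => //.
have iYoo : (\int[m2]_y `|y%:E| < +oo)%E.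
  rewrite /m2 ge0_integral_distribution //.
  by move/integrableP : iY => [].
have iXoo : (\int[m1]_y `|y%:E| < +oo)%E.
  rewrite /m1 ge0_integral_distribution //.
  by move/integrableP : iX => [].
(* Tonelli: the iterated integral of [|x y|] is the product of two finite absolute moments. *)
have if12 : (m1 \x m2)%E.-integrable setT f.
  apply/integrable12ltyP => //.
  under eq_integral => x _.
    under eq_integral => y _ do rewrite /f /= normrM EFinM.
    rewrite ge0_integralZl //=.
    over.
  rewrite /= ge0_integralZr //=.
    apply: lte_mul_pinfty => //; first exact: integral_ge0.
    by rewrite ge0_fin_numE ?integral_ge0.
  exact: integral_ge0.
have iXY : P.-integrable setT (f \o XY).
  apply/integrableP; split; first exact: measurableT_comp.
  have : (\int[m12]_z `|f z| < +oo)%E.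
    rewrite -(eq_measure_integral _ E12).
    by move/integrableP : if12 => [].
  by rewrite /m12 ge0_integral_distribution //; exact: measurableT_comp.
split=> //; rewrite /Rintegral.
have -> : (\int[P]_w (X w * Y w)%:E =
    (\int[P]_w (X w)%:E) * (\int[P]_w (Y w)%:E))%E.
  transitivity (\int[P]_w (f \o XY) w)%E => //.
  rewrite -integral_distribution // -/m12 -(eq_measure_integral _ E12).
  rewrite -integral12_prod_meas1 //.
  have iXE : m1.-integrable setT EFin by exact/integrableP.
  have iYE : m2.-integrable setT EFin by exact/integrableP.
  transitivity (\int[m1]_x (x%:E * \int[m2]_y y%:E))%E.
    by apply: eq_integral => x _; rewrite /fubini_F -integralZl //.
  rewrite -(@fineK _ (\int[m2]_y y%:E)%E) ?integrable_fin_num //.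
  rewrite integralZr // fineK ?integrable_fin_num //.
  by rewrite /m1 /m2 !integral_distribution.
rewrite fineM //; exact: integrable_fin_num.
Qed.

End independence.

(** * The sigma-algebra of finitely many samples *)

Section history.
Context {R : realType} {d : measure_display} {Omega : measurableType d}.
Context {d' : measure_display} {T' : measurableType d'}.
Variables (P : probability Omega R) (X : nat -> {RV P >-> T'}).

(* A pi-system generating the sigma-algebra of [(X k)_(k in J)]. *)
Definition history_cylinders (J : {fset nat}) : set (set Omega) :=
  [set E | exists2 U : nat -> set T', (forall k, measurable (U k)) &
    E = \bigcap_(k in [set` J]) X k @^-1` U k].

Lemma history_cylinders_measurable J : history_cylinders J `<=` measurable.
Proof.
move=> _ [U mU ->]; apply: fin_bigcap_measurable => [|k _].
  exact: finite_fset.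
exact: measurable_funPTI.
Qed.

Lemma history_cylinders_setI J : setI_closed (history_cylinders J).
Proof.
move=> _ _ [U mU ->] [V mV ->]; exists (fun k => U k `&` V k).
  by move=> k; exact: measurableI.
by rewrite -bigcapI; apply: eq_bigcapr => k _; rewrite preimage_setI.
Qed.

Lemma history_measurable (J : {fset nat}) k : k \in J ->
  measurable_fun [set: g_sigma_algebraType (history_cylinders J)]
    (X k : g_sigma_algebraType (history_cylinders J) -> T').
Proof.
move=> kJ _ U mU; rewrite setTI; apply: sub_sigma_algebra.
exists (fun i => if i == k then U else setT) => [i|]; first by case: ifP.
apply/seteqP; split=> [w Uw i /= _|w /(_ k kJ)]; last by rewrite /= eqxx.
by case: eqP => // ->.
Qed.

(** As functions of [E] both sides are finite measures. They agree on cylinders by the product rule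
    over [J] with [l] added, hence on the generated sigma-algebra. *)
Lemma independent_history (J : {fset nat}) l (U : set T') (E : set Omega) :
  independent_seq X -> l \notin J -> measurable U ->
  <<s history_cylinders J >> E ->
  P (X l @^-1` U `&` E) = (P (X l @^-1` U) * P E)%E.
Proof.
move=> indep lJ mU sE.
have mA : measurable (X l @^-1` U) by exact: measurable_funPTI.
have fA : P (X l @^-1` U) \is a fin_num by exact: fin_num_measure.
have rA : 0 <= fine (P (X l @^-1` U)) by exact: fine_ge0.
pose m1 : {measure set Omega -> \bar R} := mrestr P mA.
pose m2 : {measure set Omega -> \bar R} := mscale (NngNum rA) P.
suff : m1 E = m2 E.
  by rewrite /m1 /m2 /= /mrestr /mscale /= fineK // setIC.
apply: (@g_sigma_algebra_measure_unique _ _ _ (history_cylinders J) _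
  (fun=> setT)) sE.
- exact: history_cylinders_measurable.
- move=> _; exists (fun=> setT) => //.
  by apply/esym; rewrite -subTset => w _ k _.
- by rewrite bigcup_const //; exists 0%N.
- exact: history_cylinders_setI.
- move=> _ [V mV ->]; rewrite /m1 /m2 /= /mrestr /mscale /= fineK //.
  (* As [l] is outside [J], setting the side at [l] to [U] leaves the cylinder over [J]
     unchanged. *)
  pose V' k := if k == l then U else V k.
  have mV' k : measurable (V' k) by rewrite /V'; case: ifP.
  have := indep (l |` J)%fset V' mV'.
  have V'J k : k \in J -> V' k = V k.
    by move=> kJ; rewrite /V'; case: eqP => // kl; rewrite -kl kJ in lJ.
  rewrite big_fsetU1 //= {2}/V' eqxx.
  rewrite (eq_big_seq (fun k => P (X k @^-1` V k))); last first.
    by move=> k kJ; rewrite V'J.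
  rewrite -indep // => <-; congr (P _); apply/seteqP; split=> w.
    move=> [HV HU] k /=; rewrite in_fset1U => /predU1P[->|kJ].
      by rewrite /V' eqxx.
    by rewrite V'J //; exact: HV.
  move=> H; split=> [k /= kJ|].
    by have := H k; rewrite /= in_fset1U kJ orbT V'J //; exact.
  by have := H l; rewrite /= in_fset1U eqxx /V' eqxx; exact.
- by move=> k; rewrite /m1 /= /mrestr setTI -ge0_fin_numE.
Qed.

End history.

(** * Bounded variables and expectations of random matrices *)

Section bounded_measurable.
Context {R : realType} {d : measure_display} {T : measurableType d}.
Variable P : probability T R.
Implicit Types (f g : T -> R).

(** Unlike integrability, this is stable under products, as quadratic forms in the iterates
    require. *)
Definition bounded_measurable f :=
  measurable_fun setT f /\ exists M, forall w, `|f w| <= M.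

Lemma bounded_measurable_cst a : bounded_measurable (fun=> a).
Proof. by split; [exact: measurable_cst|exists `|a|]. Qed.

Lemma bounded_measurableD f g : bounded_measurable f -> bounded_measurable g ->
  bounded_measurable (fun w => f w + g w).
Proof.
move=> [mf [M fM]] [mg [N gN]]; split; first exact: measurable_funD.
by exists (M + N) => w; rewrite (le_trans (ler_normD _ _)) // lerD.
Qed.

Lemma bounded_measurableM f g : bounded_measurable f -> bounded_measurable g ->
  bounded_measurable (fun w => f w * g w).
Proof.
move=> [mf [M fM]] [mg [N gN]]; split; first exact: measurable_funM.
by exists (M * N) => w; rewrite normrM ler_pM.
Qed.

Lemma bounded_measurable_sum I (s : seq I) (h : I -> T -> R) :
  (forall i, bounded_measurable (h i)) ->
  bounded_measurable (fun w => \sum_(i <- s) h i w).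
Proof.
move=> bh; elim: s => [|i s IH].
  by under eq_fun do rewrite big_nil; exact: bounded_measurable_cst.
by under eq_fun do rewrite big_cons; exact: bounded_measurableD.
Qed.

Lemma bounded_measurable_integrable f :
  bounded_measurable f -> P.-integrable setT (EFin \o f).
Proof.
move=> [mf [M fM]]; apply: measurable_bounded_integrable => //.
  by rewrite -ge0_fin_numE ?fin_num_measure.
exists M; split; first exact: num_real.
by move=> x /ltW Mx w _ /=; rewrite (le_trans (fM w)).
Qed.

Lemma expectation_Rintegral f :
  P.-integrable setT (EFin \o f) -> 'E_P[f]%E = (\int[P]_w f w)%:E.
Proof. by move=> fi; rewrite unlock /Rintegral fineK // integrable_fin_num. Qed.

Lemma fine_expectation f : fine 'E_P[f]%E = \int[P]_w f w.
Proof. by rewrite unlock. Qed.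

Lemma integrable_EFinZ a f : P.-integrable setT (EFin \o f) ->
  P.-integrable setT (EFin \o (fun w => a * f w)).
Proof.
move=> fi; rewrite (_ : EFin \o _ = (fun w => a%:E * (EFin \o f) w)%E) //.
exact: integrableZl.
Qed.

Lemma integrable_EFinD f g :
  P.-integrable setT (EFin \o f) -> P.-integrable setT (EFin \o g) ->
  P.-integrable setT (EFin \o (fun w => f w + g w)).
Proof.
move=> fi gi; rewrite (_ : EFin \o _ = (EFin \o f) \+ (EFin \o g))%E //.
exact: integrableD.
Qed.

Lemma Rintegral_sum I (s : seq I) (h : I -> T -> R) :
  (forall i, P.-integrable setT (EFin \o h i)) ->
  P.-integrable setT (EFin \o (fun w => \sum_(i <- s) h i w)) /\
  \int[P]_w (\sum_(i <- s) h i w) = \sum_(i <- s) \int[P]_w h i w.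
Proof.
move=> ih; elim: s => [|i s [IH1 IH2]].
  rewrite big_nil.
  have -> : (fun w => \sum_(i <- [::]) h i w) = (fun=> 0).
    by apply/funext => w; rewrite big_nil.
  split; first exact: integrable0.
  by rewrite Rintegral_cst // mul0r.
have -> : (fun w => \sum_(i <- i :: s) h i w) =
    (fun w => h i w + \sum_(i <- s) h i w).
  by apply/funext => w; rewrite big_cons.
by split; [exact: integrable_EFinD|rewrite RintegralD // IH2 big_cons].
Qed.

Lemma mx_integrableM q r s t (L : 'M[R]_(q, r)) (X : T -> 'M[R]_(r, s))
    (N : 'M[R]_(s, t)) :
  mx_integrable P X -> mx_integrable P (fun w => L *m X w *m N).
Proof.
move=> iX i j.
have -> : (fun w => ((L *m X w *m N) i j)%:E) =
    EFin \o (fun w => \sum_l \sum_k (L i k * N l j) * X w k l).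
  apply/funext => w /=; rewrite mxE; congr EFin; apply: eq_bigr => l _.
  rewrite mxE mulr_suml; apply: eq_bigr => k _; ring.
apply: (Rintegral_sum _ _).1 => l; apply: (Rintegral_sum _ _).1 => k.
exact/integrable_EFinZ/iX.
Qed.

Lemma qnorm_mx_expectation q (X : T -> 'M[R]_q) v : mx_integrable P X ->
  P.-integrable setT (EFin \o (fun w => qnorm (X w) v)) /\
  qnorm (mx_expectation P X) v = \int[P]_w qnorm (X w) v.
Proof.
move=> iX.
have -> : (fun w => qnorm (X w) v) =
    (fun w => \sum_i \sum_j (v i 0 * v j 0) * X w i j).
  apply/funext => w; rewrite qnorm_entries.
  by apply: eq_bigr => i _; apply: eq_bigr => j _; ring.
have iE i j : P.-integrable setT (EFin \o (fun w => v i 0 * v j 0 * X w i j)).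
  exact/integrable_EFinZ/iX.
have iS i := Rintegral_sum (index_enum 'I_q) (iE i).
have [-> ->] := Rintegral_sum (index_enum 'I_q) (fun i => (iS i).1).
split=> //; rewrite qnorm_entries; apply: eq_bigr => i _.
rewrite (iS i).2; apply: eq_bigr => j _.
rewrite RintegralZl //; last exact: iX.
by rewrite mxE fine_expectation; ring.
Qed.

Lemma mx_expectation_psd q (X : T -> 'M[R]_q) : mx_integrable P X ->
  (forall w, possemidefmx (X w)) -> possemidefmx (mx_expectation P X).
Proof.
move=> iX Xp; split=> [|v].
  apply/matrixP => i j; rewrite !mxE; congr (fine 'E_P[_]%E).
  by apply/funext => w; rewrite -[in LHS](Xp w).1 mxE.
rewrite (qnorm_mx_expectation v iX).2; apply: Rintegral_ge0 => w _.
exact: (Xp w).2.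
Qed.

(** Substituting [Q^(1/2) u] reduces this to [lambda_min_pos_qnorm]. The kernel of [EX] is given as
    the zero set of its quadratic form, which can be integrated sample by sample. *)
Lemma lambda_min_pos_scaled q (X : T -> 'M[R]_q) (Q : 'M[R]_q) :
  mx_integrable P X -> (forall w, possemidefmx (X w)) -> posdefmx Q ->
  let EX := mx_expectation P X in
  let lam := lambda_min_pos
    (mx_expectation P (fun w => invsqrtmx Q *m X w *m invsqrtmx Q)) in
  ((exists v, qnorm EX v != 0) -> 0 < lam) /\
  forall u, (forall v, qnorm EX v = 0 -> (u^T *m Q *m v) 0 0 = 0) ->
    lam * qnorm Q u <= qnorm EX u.
Proof.
move=> iX Xp Qp EX lam.
have Cs := invsqrtmx_sym Qp; have Cu := sqrtmx_unit Qp.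
have [[Ss _] SS] := sqrtmxP (posdefmx_psd Qp).
have iY := mx_integrableM (invsqrtmx Q) (invsqrtmx Q) iX.
have YE w v : qnorm (invsqrtmx Q *m X w *m invsqrtmx Q) v =
    qnorm (X w) (invsqrtmx Q *m v) by rewrite -{1}Cs qnorm_mull.
have Yp w : possemidefmx (invsqrtmx Q *m X w *m invsqrtmx Q).
  by rewrite -{1}Cs; exact: possemidefmx_congr.
have EY v : qnorm (mx_expectation P
    (fun w => invsqrtmx Q *m X w *m invsqrtmx Q)) v =
    qnorm EX (invsqrtmx Q *m v).
  rewrite (qnorm_mx_expectation _ iX).2 (qnorm_mx_expectation _ iY).2.
  by apply: eq_Rintegral => w _; rewrite YE.
have EYp := mx_expectation_psd iY Yp.
split=> [[v v0]|u uort].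
  apply: lambda_min_pos_gt0 => //; apply: contraNneq v0 => EY0.
  by rewrite -[v](mulKmx Cu) -EY EY0 qnorm0l.
have -> : qnorm Q u = qnorm 1%:M (sqrtmx Q *m u) by rewrite -qnorm_sym_sqr ?SS.
rewrite -[u in leRHS](mulKmx Cu) -EY; apply: lambda_min_pos_qnorm => // w Yw.
(* A kernel vector [w] of the scaled matrix comes from [Q^(-1/2) w], and [Q Q^(-1/2) = Q^(1/2)]
   moves the orthogonality over. *)
have := uort (invsqrtmx Q *m w); rewrite -EY /qnorm -!mulmxA Yw !mulmx0 mxE.
move=> /(_ erefl); rewrite -{1}SS /invsqrtmx -mulmxA mulKVmx //.
by rewrite trmx_mul Ss mulmxA.
Qed.

End bounded_measurable.

(** With [y = Q^(1/2) u], each entry obeys [|y_j| <= 1 + y_j^2 <= 1 + |u|_Q^2]. The constant adds up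
    all entries of [Q^(-1/2)] in absolute value, so it dominates every row sum and does not depend
    on [i]. *)
Lemma posdefmx_entry_bound (R : realType) n (Q : 'M[R]_n) : posdefmx Q ->
  exists2 c : R, 0 <= c &
    forall (u : 'cV[R]_n) i, `|u i 0| <= c * (1 + qnorm Q u).
Proof.
move=> Qp; have Cu := sqrtmx_unit Qp.
have [[Ss _] SS] := sqrtmxP (posdefmx_psd Qp).
exists (\sum_i \sum_j `|invmx (sqrtmx Q) i j|) => [|u i].
  by apply: sumr_ge0 => i _; apply: sumr_ge0.
have -> : qnorm Q u = qnorm 1%:M (sqrtmx Q *m u) by rewrite -qnorm_sym_sqr ?SS.
rewrite -[u in leLHS](mulKmx Cu); move: (sqrtmx Q *m u) => y.
rewrite mxE (le_trans (ler_norm_sum _ _ _)) //.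
rewrite [X in _ <= X * _](bigD1 i) //= mulrDl.
rewrite ler_wpDr //.
  rewrite mulr_ge0 ?addr_ge0 ?qnorm1_ge0 // ?sumr_ge0 // => j _.
  exact: sumr_ge0.
rewrite mulr_suml; apply: ler_sum => j _; rewrite normrM ler_wpM2l //.
have yj : y j 0 ^+ 2 <= qnorm 1%:M y.
  by rewrite qnorm1E (bigD1 j) //= lerDl sumr_ge0 // => l _; exact: sqr_ge0.
rewrite -real_normK ?num_real // in yj; have := normr_ge0 (y j 0); nra.
Qed.

(** Jensen by the variance identity: with [c] the mean, the sum of the [|a l - c|_M^2] equals the
    sum of the [|a l|_M^2] minus [k |c|_M^2]. *)
Lemma qnorm_mean (R : realType) n (M : 'M[R]_n) (a : nat -> 'cV[R]_n) k :
  possemidefmx M -> (0 < k)%N ->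
  qnorm M (k%:R^-1 *: \sum_(0 <= l < k) a l) <=
  k%:R^-1 * \sum_(0 <= l < k) qnorm M (a l).
Proof.
move=> [Ms Mp] k0; set c := _ *: _.
have k0' : k%:R != 0 :> R by rewrite pnatr_eq0 -lt0n.
have : 0 <= \sum_(0 <= l < k) qnorm M (a l - c) by apply: sumr_ge0.
have cross : \sum_(0 <= l < k) ((a l)^T *m M *m c) 0 0 = k%:R * qnorm M c.
  rewrite -trmx_sum_mul.
  have -> : \sum_(0 <= l < k) a l = k%:R *: c by rewrite scalerA divff ?scale1r.
  by rewrite [(_ *: c)^T]linearZ /= -!scalemxAl mx11Z.
have -> : \sum_(0 <= l < k) qnorm M (a l - c) =
    \sum_(0 <= l < k) qnorm M (a l) - k%:R * qnorm M c.
  transitivity (\sum_(0 <= l < k)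
      (qnorm M (a l) + qnorm M c - 2 * ((a l)^T *m M *m c) 0 0)).
    apply: eq_bigr => l _; rewrite qnormDr // -scaleN1r qnormZr sqrrN expr1n.
    by rewrite mul1r -scalemxAr mx11Z mulN1r mulrN.
  rewrite sumrB big_split /= -big_distrr /= cross sumr_const_nat subn0.
  by rewrite -mulr_natl; ring.
by rewrite subr_ge0 ler_pdivlMl ?ltr0n.
Qed.

(** * Averaging over a fresh sample *)

Section sampling.
Context {R : realType} {d : measure_display} {Omega : measurableType d}.
Context {d' : measure_display} {T' : measurableType d'}.
Variables (P : probability Omega R) (D : probability T' R).
Variables (X : nat -> {RV P >-> T'}) (X_iid : iid_seq D X).

Lemma iid_Rintegral l (f : T' -> R) : D.-integrable setT (EFin \o f) ->
  P.-integrable setT (EFin \o (f \o X l)) /\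
  \int[P]_w f (X l w) = \int[D]_t f t.
Proof.
move=> fi; have /measurable_int mf := fi.
have DE A : measurable A -> A `<=` setT -> D A = distribution P (X l) A.
  by have [_ XD] := X_iid; move=> mA _; rewrite XD.
have fXi : P.-integrable setT (EFin \o (f \o X l)).
  apply/integrableP; split; first exact: measurableT_comp mf _.
  move/integrableP : fi => [_].
  rewrite (eq_measure_integral _ DE) ge0_integral_distribution //.
  exact: measurableT_comp.
split=> //; rewrite /Rintegral; congr fine.
by rewrite [in RHS](eq_measure_integral _ DE) integral_distribution.
Qed.

Lemma iid_history_Rintegral (J : {fset nat}) l (f : T' -> R) (g : Omega -> R) :
  l \notin J -> D.-integrable setT (EFin \o f) -> bounded_measurable g ->
  measurable_fun [set: g_sigma_algebraType (history_cylinders X J)]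
    (g : g_sigma_algebraType (history_cylinders X J) -> R) ->
  P.-integrable setT (EFin \o (fun w => f (X l w) * g w)) /\
  \int[P]_w (f (X l w) * g w) = \int[D]_t f t * \int[P]_w g w.
Proof.
move=> lJ fi gb gJ.
have [fXi fXE] := iid_Rintegral l fi.
have /measurable_int/measurable_EFinP mf := fi.
rewrite -fXE; apply: independent_Rintegral => //.
  exact: bounded_measurable_integrable.
move=> U V mU mV.
have gV : <<s history_cylinders X J >> (g @^-1` V).
  by have := gJ measurableT _ mV; rewrite setTI.
have fU : measurable (f @^-1` U).
  by have := mf measurableT _ mU; rewrite setTI.
have [X_indep _] := X_iid; exact: (independent_history X_indep lJ fU gV).
Qed.

(** Stands in for conditioning on the past: the form is a sum of products of [M i j], which depends
    on sample [l], with [u i * u j], which depends on [J], and each product factors. *)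
Lemma iid_history_qnorm (J : {fset nat}) l q (M : T' -> 'M[R]_q)
    (u : Omega -> 'cV[R]_q) :
  l \notin J -> mx_integrable D M ->
  (forall i, bounded_measurable (fun w => u w i 0)) ->
  mx_measurable (u : g_sigma_algebraType (history_cylinders X J) -> _) ->
  P.-integrable setT (EFin \o (fun w => qnorm (M (X l w)) (u w))) /\
  \int[P]_w qnorm (M (X l w)) (u w) =
  \int[P]_w qnorm (mx_expectation D M) (u w).
Proof.
move=> lJ Mi ub uJ.
have uub i j : bounded_measurable (fun w => u w i 0 * u w j 0).
  exact: bounded_measurableM.
have uuJ i j : measurable_fun [set: g_sigma_algebraType (history_cylinders X J)]
    ((fun w => u w i 0 * u w j 0) : g_sigma_algebraType _ -> R).
  by apply: measurable_funM; exact: uJ.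
have step i j := iid_history_Rintegral lJ (Mi i j) (uub i j) (uuJ i j).
have qE (N : Omega -> 'M[R]_q) : (fun w => qnorm (N w) (u w)) =
    (fun w => \sum_i \sum_j N w i j * (u w i 0 * u w j 0)).
  apply/funext => w; rewrite qnorm_entries.
  by apply: eq_bigr => i _; apply: eq_bigr => j _; ring.
rewrite (qE (fun w => M (X l w))) (qE (fun=> mx_expectation D M)).
have s1 i := Rintegral_sum (index_enum 'I_q) (fun j => (step i j).1).
have [i1 ->] := Rintegral_sum (index_enum 'I_q) (fun i => (s1 i).1).
split=> //.
have ui i j : P.-integrable setT (EFin \o
    (fun w => mx_expectation D M i j * (u w i 0 * u w j 0))).
  exact/integrable_EFinZ/bounded_measurable_integrable.
have s2 i := Rintegral_sum (index_enum 'I_q) (ui i).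
rewrite (Rintegral_sum (index_enum 'I_q) (fun i => (s2 i).1)).2.
apply: eq_bigr => i _; rewrite (s1 i).2 (s2 i).2; apply: eq_bigr => j _.
rewrite (step i j).2 RintegralZl //; last exact: bounded_measurable_integrable.
by rewrite mxE fine_expectation.
Qed.

End sampling.

(** * ALS iterates *)

Section als_iterates.
Variables (R : realType) (m n p : nat) (A : 'M[R]_(m, n)) (b : 'cV[R]_m).
Variables (B : 'M[R]_n) (G : 'M[R]_p) (rho : R).
Hypotheses (B_pd : posdefmx B) (G_pd : posdefmx G) (rho_gt0 : 0 < rho).
Variables (x0 : 'cV[R]_n) (z0 : 'cV[R]_p).

Let rhoV_gt0 : 0 < rho^-1. Proof. by rewrite invr_gt0. Qed.

Local Notation iter s l := (als_iter A b B G rho x0 z0 s l).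
Local Notation Z := (als_Z A B G rho).
Local Notation W := (als_W A B G rho).

Lemma als_iterS (s : nat -> 'M[R]_(m, p)) l : iter s l.+1 =
  als_step A b B G rho (s l) ((iter s l).1, (iter s l).2).
Proof.
rewrite [iter s l.+1]/(als_step A b B G rho (s l) (iter s l)).
by case: (iter s l).
Qed.

Lemma als_iterS2 (s : nat -> 'M[R]_(m, p)) l : (iter s l.+1).2 =
  als_H A B G rho (s l) *m ((s l)^T *m A *m (iter s l).1 - (s l)^T *m b
    + rho^-1 *: (G *m (iter s l).2)).
Proof. by rewrite als_iterS. Qed.

Lemma als_iterS1 (s : nat -> 'M[R]_(m, p)) l : (iter s l.+1).1 =
  (iter s l).1 - invmx B *m A^T *m s l *m (iter s l.+1).2.
Proof. by rewrite als_iterS. Qed.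

Lemma als_H_measurable d (T : measurableType d) (S : T -> 'M[R]_(m, p)) :
  mx_measurable S -> mx_measurable (fun w => als_H A B G rho (S w)).
Proof.
move=> mS; apply: mx_measurable_inv => [w|]; first exact/posdefmx_unit/als_K_pd.
apply: mx_measurableD; first exact: mx_measurable_cst.
apply: mx_measurableM => //.
do 3 (apply: mx_measurableM; last exact: mx_measurable_cst).
exact: mx_measurable_tr.
Qed.

(** The measurable structure on [T] is left free: the lemma serves for [Omega] itself and for the
    sigma-algebra of the first [l] samples, which is why only indices below [l] are required. *)
Lemma als_iter_measurable d (T : measurableType d)
    (s : nat -> T -> mxborel R m p) l :
  (forall k, (k < l)%N -> measurable_fun setT (s k)) ->
  mx_measurable (fun w => (iter (fun k => s k w) l).1) /\
  mx_measurable (fun w => (iter (fun k => s k w) l).2).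
Proof.
elim: l => [|l IH] ms; first by split; exact: mx_measurable_cst.
have [mx mz] := IH (fun k kl => ms k (ltnW kl)).
have mS : mx_measurable (s l : T -> 'M[R]_(m, p)).
  exact/mx_measurable_mxborel/ms.
have mSt := mx_measurable_tr mS.
have mz' : mx_measurable (fun w => (iter (fun k => s k w) l.+1).2).
  under eq_fun do rewrite als_iterS2.
  apply: mx_measurableM; first exact: als_H_measurable.
  apply: mx_measurableD.
    apply: mx_measurableD.
      by apply: mx_measurableM => //; exact: mx_measurableM.
    exact/mx_measurableN/mx_measurableM.
  exact/mx_measurableZ/mx_measurableM.
split=> //; under eq_fun do rewrite als_iterS1.
apply: mx_measurableD => //; apply/mx_measurableN/mx_measurableM => //.
exact: mx_measurableM.
Qed.

Variable xs : 'cV[R]_n.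
Hypothesis xsE : A *m xs = b.

Lemma als_V_iter (s : nat -> 'M[R]_(m, p)) l :
  als_V B G xs (iter s l.+1).1 (iter s l.+1).2 rho =
  als_V B G xs (iter s l).1 (iter s l).2 rho -
  (qnorm (Z (s l)) ((iter s l).1 - xs) + rho^-1 * qnorm (W (s l)) (iter s l).2).
Proof. by rewrite als_iterS als_V_step. Qed.

Lemma als_V_iter_le (s : nat -> 'M[R]_(m, p)) l :
  als_V B G xs (iter s l).1 (iter s l).2 rho <= als_V B G xs x0 z0 rho.
Proof.
elim: l => // l; apply: le_trans; rewrite als_V_iter gerBl.
rewrite addr_ge0 ?mulr_ge0 ?(ltW rhoV_gt0) //.
  exact: (als_Z_psd A B_pd G_pd rho_gt0 _).2.
exact: (als_W_psd A B_pd G_pd rho_gt0 _).2.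
Qed.

(** [V] never exceeds its initial value along any sample path and controls both components, so [c]
    depends neither on [s] nor on [l]. *)
Lemma als_iter_bounded : exists c, forall (s : nat -> 'M[R]_(m, p)) l,
  (forall i, `|((iter s l).1 - xs) i 0| <= c) /\
  (forall i, `|(iter s l).2 i 0| <= c).
Proof.
have [c1 c1_ge0 c1P] := posdefmx_entry_bound B_pd.
have [c2 c2_ge0 c2P] := posdefmx_entry_bound (posdefmxZ rhoV_gt0 G_pd).
set V0 := als_V B G xs x0 z0 rho.
exists (Num.max (c1 * (1 + V0)) (c2 * (1 + V0))) => s l.
have qB_ge0 := (posdefmx_psd B_pd).2 ((iter s l).1 - xs).
have qG_ge0 := (posdefmx_psd (posdefmxZ rhoV_gt0 G_pd)).2 (iter s l).2.
have VE : qnorm B ((iter s l).1 - xs) + qnorm (rho^-1 *: G) (iter s l).2 <= V0.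
  by rewrite qnormZl; exact: als_V_iter_le.
split=> i; rewrite le_max; apply/orP; [left|right].
  by rewrite (le_trans (c1P _ _)) // ler_wpM2l //; lra.
by rewrite (le_trans (c2P _ _)) // ler_wpM2l //; lra.
Qed.

Lemma als_iter_orthogonal (v : 'cV[R]_n) (s : nat -> 'M[R]_(m, p)) l :
  A *m v = 0 ->
  ((x0 - xs)^T *m B *m v) 0 0 = 0 ->
  (((iter s l).1 - xs)^T *m B *m v) 0 0 = 0.
Proof.
move=> Av x0v; elim: l => // l IH.
by rewrite als_iterS; exact: als_step_orthogonal.
Qed.

Lemma als_xbarB (s : nat -> 'M[R]_(m, p)) k : (0 < k)%N ->
  als_xbar A b B G rho x0 z0 s k - xs =
  k%:R^-1 *: \sum_(0 <= l < k) ((iter s l).1 - xs).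
Proof.
move=> k0; rewrite sumrB scalerBr sumr_const_nat subn0 -[xs *+ k]scaler_nat.
by rewrite scalerA mulVf ?pnatr_eq0 -?lt0n // scale1r.
Qed.

End als_iterates.

(** * Expected bounds at the averaged iterates *)

Theorem theorem3p8 (R : realType) (m n p : nat) (p_gt0 : (0 < p)%N)
    (A : 'M[R]_(m, n)) (b : 'cV[R]_m)
    (Ab_consistent : exists x : 'cV[R]_n, A *m x = b)
    (B : 'M[R]_n) (G : 'M[R]_p) (B_pd : posdefmx B) (G_pd : posdefmx G)
    (rho : R) (rho_gt0 : 0 < rho)
    (D : probability (mxborel R m p) R)
    (SHS_int : mx_integrable D (als_SHS A B G rho))
    (Z_int : mx_integrable D (als_Z A B G rho))
    (W_int : mx_integrable D (als_W A B G rho))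
    (null_SHS : forall u : 'cV[R]_m,
       mx_expectation D (als_SHS A B G rho) *m u = 0 -> A^T *m u = 0)
    (EW_pd : posdefmx (mx_expectation D (als_W A B G rho)))
    (d : measure_display) (Omega : measurableType d) (P : probability Omega R)
    (S : nat -> {RV P >-> mxborel R m p}) (S_iid : iid_seq D S)
    (x0 : 'cV[R]_n) (z0 : 'cV[R]_p) (k : nat) (k_gt0 : (0 < k)%N) :
  let xs := als_xstar A b B x0 in
  let mu := als_mu A B G D rho in
  let xbar := fun w : Omega =>
    als_xbar A b B G rho x0 z0 (fun l => S l w) k in
  let zbar := fun w : Omega =>
    als_zbar A b B G rho x0 z0 (fun l => S l w) k in
  let EZ := mx_expectation D (als_Z A B G rho) in
  let EW := mx_expectation D (als_W A B G rho) in
  [/\ ('E_P[fun w => als_V B G xs (xbar w) (zbar w) rho]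
        = 'E_P[fun w => qnorm B (xbar w - xs)%R]
           + (rho^-1)%:E * 'E_P[fun w => qnorm G (zbar w)])%E,
      ('E_P[fun w => als_V B G xs (xbar w) (zbar w) rho]
        <= ((mu * k%:R)^-1 * als_V B G xs x0 z0 rho)%:E)%E,
      (2%:E * 'E_P[fun w => als_f A B G D xs (xbar w) (zbar w) rho]
        = 'E_P[fun w => qnorm EZ (xbar w - xs)%R]
           + (rho^-1)%:E * 'E_P[fun w => qnorm EW (zbar w)])%E &
      (2%:E * 'E_P[fun w => als_f A B G D xs (xbar w) (zbar w) rho]
        <= (k%:R^-1 * als_V B G xs x0 z0 rho)%:E)%E].
Proof.
move=> xs mu xbar zbar EZ EW.
have rhoV_gt0 : 0 < rho^-1 by rewrite invr_gt0.
have k0 : 0 < k%:R :> R by rewrite ltr0n.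
have Zp := als_Z_psd A B_pd G_pd rho_gt0.
have Wp := als_W_psd A B_pd G_pd rho_gt0.
have EZp : possemidefmx EZ := mx_expectation_psd Z_int Zp.
have [xsE x0_orth] := als_xstarP B_pd x0 Ab_consistent.
rewrite -/xs in xsE x0_orth.
(* [|v|^2] in [E Z] is [|A v|^2] in [E[SHS]]; the null space assumption then yields [A^T A v = 0],
   so [|A v|^2 = 0]. *)
have EZ_ker v : qnorm EZ v = 0 -> A *m v = 0.
  rewrite (qnorm_mx_expectation v Z_int).2 => Zv0.
  have SHSp := mx_expectation_psd SHS_int (als_SHS_psd A B_pd G_pd rho_gt0).
  have : mx_expectation D (als_SHS A B G rho) *m (A *m v) = 0.
    apply: possemidefmx_ker SHSp _; rewrite (qnorm_mx_expectation _ SHS_int).2.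
    rewrite -[RHS]Zv0; apply: eq_Rintegral => w _.
    by rewrite als_Z_SHS qnorm_mull.
  move=> /null_SHS AtAv; apply: qnorm1_eq0.
  by rewrite /qnorm mulmx1 trmx_mul -mulmxA AtAv mulmx0 mxE.
pose u l w := (als_iter A b B G rho x0 z0 (fun i => S i w) l).1 - xs.
pose z l w := (als_iter A b B G rho x0 z0 (fun i => S i w) l).2.
have [c cP] := als_iter_bounded B_pd G_pd rho_gt0 x0 z0 xsE.
have [uzm uzb] : (forall l, mx_measurable (u l) /\ mx_measurable (z l)) /\
    forall l, (forall i, bounded_measurable (fun w => u l w i 0)) /\
      (forall i, bounded_measurable (fun w => z l w i 0)).
  have uzm l : mx_measurable (u l) /\ mx_measurable (z l).
    have [mx mz] := als_iter_measurable A b B_pd G_pd rho_gt0 x0 z0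
      (s := fun l w => S l w) (l := l) (fun i _ => measurable_funPT (S i)).
    by split=> //; apply: mx_measurableD => //; exact: mx_measurable_cst.
  split=> // l; split=> i; split; try exact: (uzm l).1; try exact: (uzm l).2.
    by exists c => w; have [+ _] := cP (fun i => S i w) l; exact.
  by exists c => w; have [_ +] := cP (fun i => S i w) l; exact.
have qb q (M : 'M[R]_q) (y : Omega -> 'cV[R]_q) :
    (forall i, bounded_measurable (fun w => y w i 0)) ->
    bounded_measurable (fun w => qnorm M (y w)).
  move=> yb; under eq_fun do rewrite qnorm_entries.
  apply: bounded_measurable_sum => i; apply: bounded_measurable_sum => j.
  apply: bounded_measurableM => //; apply: bounded_measurableM => //.
  exact: bounded_measurable_cst.
have mean_b q (y : nat -> Omega -> 'cV[R]_q) :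
    (forall l i, bounded_measurable (fun w => y l w i 0)) ->
    forall i, bounded_measurable
      (fun w => (k%:R^-1 *: \sum_(0 <= l < k) y l w) i 0).
  move=> yb i.
  have -> : (fun w => (k%:R^-1 *: \sum_(0 <= l < k) y l w) i 0) =
      (fun w => k%:R^-1 * \sum_(0 <= l < k) y l w i 0).
    by apply/funext => w; rewrite mxE summxE.
  apply: bounded_measurableM; first exact: bounded_measurable_cst.
  exact: bounded_measurable_sum.
pose ubar w := k%:R^-1 *: \sum_(0 <= l < k) u l w.
have xbarE w : xbar w - xs = ubar w by rewrite /xbar als_xbarB.
have zbarE w : zbar w = k%:R^-1 *: \sum_(0 <= l < k) z l w by [].
have ub : forall i, bounded_measurable (fun w => (xbar w - xs) i 0).
  move=> i; under eq_fun do rewrite xbarE.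
  by apply: mean_b => l; exact: (uzb l).1.
have zb : forall i, bounded_measurable (fun w => zbar w i 0).
  by apply: mean_b => l; exact: (uzb l).2.
pose int f fb := @bounded_measurable_integrable R d Omega P f fb.
have qBi := int _ (qb _ B _ ub); have qGi := int _ (qb _ G _ zb).
have qZi := int _ (qb _ EZ _ ub); have qWi := int _ (qb _ EW _ zb).
(* [F] is twice [als_f] at the averages; [Fl l] below is the same at iterate [l]. *)
pose F w := qnorm EZ (xbar w - xs) + rho^-1 * qnorm EW (zbar w).
have Fi : P.-integrable setT (EFin \o F).
  exact/integrable_EFinD/integrable_EFinZ.
have Vi : P.-integrable setT
    (EFin \o (fun w => als_V B G xs (xbar w) (zbar w) rho)).
  exact/integrable_EFinD/integrable_EFinZ.
have fE : (fun w => als_f A B G D xs (xbar w) (zbar w) rho) =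
    (fun w => 2^-1 * F w).
  by apply/funext => w; rewrite /als_f /F mulrDr mulrA invfM.
have E_f : (2%:E * 'E_P[fun w => als_f A B G D xs (xbar w) (zbar w) rho])%E =
    (\int[P]_w F w)%:E.
  rewrite fE expectation_Rintegral; last exact: integrable_EFinZ.
  rewrite RintegralZl //.
  by rewrite -EFinM mulrA divff ?mul1r // pnatr_eq0.
pose Fl l w := qnorm EZ (u l w) + rho^-1 * qnorm EW (z l w).
have uli l : P.-integrable setT (EFin \o (fun w => qnorm EZ (u l w))).
  by apply: int; apply: qb; exact: (uzb l).1.
have zli l : P.-integrable setT (EFin \o (fun w => qnorm EW (z l w))).
  by apply: int; apply: qb; exact: (uzb l).2.
have Fli l : P.-integrable setT (EFin \o Fl l).
  exact/integrable_EFinD/integrable_EFinZ.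
pose Vl l w := als_V B G xs (als_iter A b B G rho x0 z0 (fun i => S i w) l).1
  (als_iter A b B G rho x0 z0 (fun i => S i w) l).2 rho.
have Vli l : P.-integrable setT (EFin \o Vl l).
  apply: integrable_EFinD; first by apply: int; apply: qb; exact: (uzb l).1.
  by apply/integrable_EFinZ/int/qb; exact: (uzb l).2.
have step l : \int[P]_w Vl l.+1 w = \int[P]_w Vl l w - \int[P]_w Fl l w.
  pose J := [fset i in iota 0 l]%fset.
  have lJ : l \notin J by rewrite !inE mem_iota ltnn.
  (* [u l] and [z l] only depend on the samples indexed by [J]. *)
  have SJ i : (i < l)%N ->
      measurable_fun [set: g_sigma_algebraType (history_cylinders S J)]
        (S i : g_sigma_algebraType (history_cylinders S J) -> mxborel R m p).
    by move=> il; apply: history_measurable; rewrite !inE mem_iota.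
  have [xJ zJ] := als_iter_measurable A b B_pd G_pd rho_gt0 x0 z0 SJ.
  have uJ := mx_measurableD xJ (mx_measurable_cst (- xs)).
  have [iZ eZ] := iid_history_qnorm S_iid lJ Z_int (uzb l).1 uJ.
  have [iW eW] := iid_history_qnorm S_iid lJ W_int (uzb l).2 zJ.
  have iZW := integrable_EFinD iZ (integrable_EFinZ rho^-1 iW).
  transitivity (\int[P]_w (Vl l w - (qnorm (als_Z A B G rho (S l w)) (u l w)
      + rho^-1 * qnorm (als_W A B G rho (S l w)) (z l w)))).
    by apply: eq_Rintegral => w _; exact: als_V_iter.
  rewrite RintegralB //; congr (_ - _).
  rewrite RintegralD //; last exact: integrable_EFinZ.
  rewrite [RHS]RintegralD //; last exact: integrable_EFinZ.
  by rewrite !RintegralZl // eZ eW.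
have sumF : \sum_(0 <= l < k) \int[P]_w Fl l w <= als_V B G xs x0 z0 rho.
  (* The telescoped sum is exact, and the bound drops the nonnegative [E V_k]. The start is
     deterministic, so its integral is its value. *)
  have : \sum_(0 <= l < k) \int[P]_w Fl l w =
      als_V B G xs x0 z0 rho - \int[P]_w Vl k w.
    elim: (k) => [|j IH]; last by rewrite big_nat_recr //= IH step; ring.
    rewrite big_geq // -[Vl 0%N]/(fun=> als_V B G xs x0 z0 rho).
    by rewrite Rintegral_cst //= probability_setT mulr1 subrr.
  move=> ->; rewrite gerBl; apply: Rintegral_ge0 => w _.
  by rewrite addr_ge0 ?mulr_ge0 ?(ltW rhoV_gt0) // (posdefmx_psd _).2.
have intF : \int[P]_w F w <= k%:R^-1 * als_V B G xs x0 z0 rho.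
  have [iS sE] := Rintegral_sum (index_iota 0 k) Fli.
  apply: (@le_trans _ _ (\int[P]_w (k%:R^-1 * \sum_(0 <= l < k) Fl l w))).
    apply: le_Rintegral => // [|w _]; first exact: integrable_EFinZ.
    rewrite /F xbarE zbarE big_split -mulr_sumr mulrDr mulrCA.
    rewrite lerD ?ler_wpM2l ?(ltW rhoV_gt0) ?qnorm_mean //.
    exact: posdefmx_psd.
  by rewrite RintegralZl // sE ler_pM2l ?invr_gt0.
have [mu_gt0 muV] : 0 < mu /\
    forall w, mu * als_V B G xs (xbar w) (zbar w) rho <= F w.
  have [lZ lZ_le] := lambda_min_pos_scaled Z_int Zp B_pd.
  have [lW lW_le] := lambda_min_pos_scaled W_int Wp G_pd.
  have mu_gt0 : 0 < mu.
    rewrite lt_min; apply/andP; split; last first.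
      apply: lW; exists (const_mx 1); rewrite gt_eqF // EW_pd.2 //.
      apply/eqP => /matrixP/(_ (Ordinal p_gt0) 0); rewrite !mxE.
      by apply/eqP; exact: oner_neq0.
    (* If the form of [E Z] vanished identically, [EZ_ker] would give [A = 0], so every [W] would be
       0 and [E W] could not be positive on the nonzero vector [const_mx 1]. *)
    apply: lZ; apply: contrapT => noZ.
    have A0 : A = 0.
      apply/matrixP => i j; have : A *m (delta_mx j 0 : 'cV_n) = 0.
        apply: EZ_ker; apply/eqP; apply: contrapT => /negP Zv.
        by apply: noZ; exists (delta_mx j 0).
      by rewrite -colE => /colP/(_ i); rewrite !mxE.
    have := EW_pd.2 (const_mx 1); rewrite (qnorm_mx_expectation _ W_int).2.
    have W0 (S' : 'M[R]_(m, p)) : als_W A B G rho S' = 0.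
      by rewrite /als_W A0 mulmx0 !mul0mx.
    under eq_Rintegral => w _ do rewrite W0 qnorm0l.
    rewrite Rintegral_cst // mul0r ltxx => H.
    suff : (const_mx 1 : 'cV[R]_p) != 0 by move=> /H.
    apply/eqP => /matrixP/(_ (Ordinal p_gt0) 0); rewrite !mxE.
    by apply/eqP; exact: oner_neq0.
  split=> // w.
  have uw : mu * qnorm B (xbar w - xs) <= qnorm EZ (xbar w - xs).
    apply: le_trans (lZ_le _ _) => [|v /EZ_ker Av].
      by rewrite ler_wpM2r ?(posdefmx_psd B_pd).2 // ge_min lexx.
    rewrite xbarE /ubar [(_ *: _)^T]linearZ /= -!scalemxAl mx11Z trmx_sum_mul.
    rewrite big1 ?mulr0 // => l _; exact: als_iter_orthogonal (x0_orth v Av).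
  (* No orthogonality has to be tracked here: only [v = 0] annihilates the form of [E W]. *)
  have zw : mu * qnorm G (zbar w) <= qnorm EW (zbar w).
    apply: le_trans (lW_le _ _) => [|v EWv].
      by rewrite ler_wpM2r ?(posdefmx_psd G_pd).2 // ge_min lexx orbT.
    have [->|/EW_pd.2] := eqVneq v 0; first by rewrite mulmx0 mxE.
    by rewrite EWv ltxx.
  by rewrite /als_V mulrDr mulrCA lerD // ler_wpM2l // ltW.
split.
- rewrite !expectation_Rintegral //; rewrite -EFinM -EFinD; congr EFin.
  by rewrite RintegralD ?RintegralZl //; exact: integrable_EFinZ.
- rewrite expectation_Rintegral // lee_fin invfM -mulrA ler_pdivlMl //.
  apply: le_trans intF; rewrite -RintegralZl //; apply: le_Rintegral => //.
  exact: integrable_EFinZ.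
- rewrite E_f !expectation_Rintegral // -EFinM -EFinD; congr EFin.
  by rewrite RintegralD ?RintegralZl //; exact: integrable_EFinZ.
- by rewrite E_f lee_fin.
Qed.
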